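(* Every quasicontinuous dcpo $P$ has weak one-step closure; that is, for every subset $A\subseteq P$, $cl(A)=A''$, where $cl(A)$ is the Scott closure of $A$ and $A''=\{x\in P\mid \text{there is a directed } D\subseteq \mathord{\downarrow}A \text{ such that } x\le \sup D\}$.
   Context: Let $P$ be a poset. For $A\subseteq P$, $\mathord{\uparrow}A=\{y\in P: x\le y\text{ for some }x\in A\}$ and $\mathord{\downarrow}A=\{y\in P: y\le x\text{ for some }x\in A\}$; $\mathord{\uparrow}x=\mathord{\uparrow}\{x\}$. A directed subset is a nonempty subset $D$ in which every finite subset has an upper bound in $D$. A subset $U$ is Scott open if $U=\mathord{\uparrow}U$ and for every directed $D$ such that $\sup D$ exists and lies in $U$, $D\cap U\neq\emptyset$; the Scott open sets form the Scott topology, and $cl$ denotes closure in it. A dcpo is a poset in which every directed subset has a supremum. In the definition of $A''$, the condition on $D$ includes that $\sup D$ exists in $P$. For subsets $G,H\subseteq P$, the Smyth preorder is $G\le H$ iff $\mathord{\uparrow}H\subseteq\mathord{\uparrow}G$. $G\ll H$ means: for every directed $D\subseteq P$ for which $\sup D$ exists, $\sup D\in\mathord{\uparrow}H$ implies $D\cap\mathord{\uparrow}G\ne\emptyset$. Write $G\ll x$ for $G\ll\{x\}$. The poset $P$ is quasicontinuous if for every $x\in P$: (1) $fin(x)=\{F\subseteq P\mid F\text{ finite}, F\ll x\}$ is a directed family (with respect to the Smyth preorder); (2) $\mathord{\uparrow}x=\bigcap_{F\in fin(x)}\mathord{\uparrow}F$. *)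

(* Defs.v *)
From HB Require Import structures.
From mathcomp Require Import all_boot all_order.
From mathcomp Require Import mathcomp_extra boolp classical_sets functions.
From mathcomp Require Import cardinality topology.

Set Implicit Arguments.
Unset Strict Implicit.
Unset Printing Implicit Defensive.

Import Order.TTheory.
Local Open Scope classical_set_scope.
Local Open Scope order_scope.

(* R is a preorder: the order of a poset, or the Smyth preorder on its
   subsets. *)
Definition directed (T : Type) (R : T -> T -> Prop) (D : set T) : Prop :=
  D !=set0 /\
  forall F : set T, finite_set F -> F `<=` D ->
    exists2 z, D z & forall x, F x -> R x z.

Section Poset.
Context {d : Order.disp_t} {P : porderType d}.
Implicit Types (A D F G H U : set P) (x s : P).

Definition up A : set P := [set y | exists2 x, A x & x <= y].

Definition directed_set D : Prop := directed (fun x y : P => x <= y) D.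

Definition scott_open U : Prop :=
  U = up U /\
  forall D s, directed_set D -> isLub D s -> U s -> D `&` U !=set0.

Definition smyth G H : Prop := up H `<=` up G.

Definition way_below G H : Prop :=
  forall D s, directed_set D -> isLub D s -> up H s -> D `&` up G !=set0.

Definition fin x : set (set P) :=
  [set F | finite_set F /\ way_below F [set x]].

(* A'' *)
Definition one_step A : set P :=
  [set x | exists D s,
     [/\ directed_set D, D `<=` down A, isLub D s & x <= s]].

Lemma sub_up A : A `<=` up A.
Proof. by move=> x Ax; exists x. Qed.

Lemma scott_openT : scott_open setT.
Proof.
split; first by apply/seteqP; split=> // x _; exact: sub_up.
by move=> D s [[x Dx] _] _ _; exists x.
Qed.

Lemma scott_openI : setI_closed scott_open.
Proof.
move=> U V [Uup Usup] [Vup Vsup]; split.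
  apply/seteqP; split; first exact: sub_up.
  move=> y [x [Ux Vx] xy]; split; first by rewrite Uup; exists x.
  by rewrite Vup; exists x.
move=> D s Ddir Ds [Us Vs].
have [x [Dx Ux]] := Usup D s Ddir Ds Us.
have [y [Dy Vy]] := Vsup D s Ddir Ds Vs.
have [||z Dz ubz] := Ddir.2 [set x; y]; first exact: finite_set2.
  by move=> _ [->|->].
exists z; split=> //; split.
  by rewrite Uup; exists x => //; apply: ubz; left.
by rewrite Vup; exists y => //; apply: ubz; right.
Qed.

Lemma scott_open_bigU (I : Type) (f : I -> set P) :
  (forall i, scott_open (f i)) -> scott_open (\bigcup_i f i).
Proof.
move=> fo; split.
  apply/seteqP; split; first exact: sub_up.
  by move=> y [x [i _ fix_] xy]; exists i => //; rewrite (fo i).1; exists x.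
move=> D s Ddir Ds [i _ fis].
by have [x [Dx fix_]] := (fo i).2 D s Ddir Ds fis; exists x; split=> //; exists i.
Qed.

End Poset.

Definition dcpo (d : Order.disp_t) (P : porderType d) : Prop :=
  forall D : set P, directed_set D -> exists s, isLub D s.

Definition quasicontinuous (d : Order.disp_t) (P : porderType d) : Prop :=
  forall x : P,
    directed smyth (fin x) /\ up [set x] = \bigcap_(F in fin x) up F.

(* The carrier of P with its Scott topology; the alias keeps it apart from any
   other topology P may carry. *)
Definition scott (d : Order.disp_t) (P : porderType d) : Type := P.

HB.instance Definition _ (d : Order.disp_t) (P : porderType d) :=
  Choice.on (scott P).

HB.instance Definition _ (d : Order.disp_t) (P : porderType d) :=
  @isOpenTopological.Build (scott P) (@scott_open d P) scott_openT
    (@scott_openI d P) (@scott_open_bigU d P).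

Definition scott_closure (d : Order.disp_t) (P : porderType d) (A : set P) :
  set P := closure (A : set (scott P)).

Lemma scott_openE (d : Order.disp_t) (P : porderType d) (U : set P) :
  open (U : set (scott P)) = scott_open U.
Proof. by []. Qed.

Definition weak_one_step_closure (d : Order.disp_t) (P : porderType d) : Prop :=
  forall A : set P, scott_closure A = one_step A.

(* Main.v *)
Require Import Defs.
From mathcomp Require Import all_boot all_order.
From mathcomp Require Import boolp classical_sets cardinality topology.

(** In the Scott closure of A, a point x is reached by a single directed
    supremum because x is determined by the finite sets F way below it, and each
    of these meets the lower set of A.

    The engine is a form of Rudin's lemma ([rudin]): if V is an upper set and
    a Smyth-directed family of finite sets has no member inside V, then some
    directed set D avoids V and meets every member of the family. In a dcpo the
    supremum of D then lies above every member ([rudin_sup]). This is used twice.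

    First, for F way below s, with s the supremum of a directed set D0, take V to
    be the upper set of F and the family of all finite E way below some element of
    D0. The supremum given by [rudin_sup] would be above all of D0, hence above
    s, and as F is way below s, D would meet V. So some such E lies in V, and
    therefore F is way below an element of D0. This says that the points which F
    is way below form a Scott open set ([scott_open_way_below]).

    Secondly, let x be in the closure of A. By this openness every F in [fin x]
    is way below some a in A, so F has a member below a. Take V to be the
    complement of the lower set of A and the family to be [fin x]: the
    result is a directed D below A whose supremum lies above every F in [fin x],
    and quasicontinuity places it above x. *)

Set Implicit Arguments.
Unset Strict Implicit.
Unset Printing Implicit Defensive.

Import Order.TTheory.
Local Open Scope classical_set_scope.
Local Open Scope order_scope.

(** Directedness lets finitely many separate witnesses be replaced by a common
    one, as long as being a witness is preserved by going up. *)
Lemma directed_common_witness (S T : Type) (R : T -> T -> Prop) (D : set T)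
    (G : set S) (Q : S -> T -> Prop) :
  directed R D -> finite_set G ->
  (forall x z w, R z w -> Q x z -> Q x w) ->
  (forall x, G x -> exists2 z, D z & Q x z) ->
  exists2 z, D z & forall x, G x -> Q x z.
Proof.
move=> [[z0 _] Ddir] finG Qmono GQ.
have [x|f fP] := @choice _ _ (fun x z => G x -> D z /\ Q x z).
  have [Gx|nGx] := pselect (G x); last by exists z0.
  by have [z Dz Qz] := GQ _ Gx; exists z.
have [_ [x Gx <-]|z Dz zub] := Ddir (f @` G) (finite_image f finG).
  exact: (fP x Gx).1.
exists z => // x Gx; apply: Qmono (fP x Gx).2.
by apply: zub; exists x.
Qed.

Lemma finite_sub_chain (T : choiceType) (C : set (set T)) (V F : set T) :
  total_on C subset -> C !=set0 -> finite_set F ->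
  F `<=` V `|` \bigcup_(X in C) X -> exists2 X, C X & F `<=` V `|` X.
Proof.
move=> Ctot [X0 CX0] /finite_seqP[s ->].
elim: s => [|a s IHs] sub; first by exists X0.
have [y ys|X CX sX] := IHs; first by apply: sub; rewrite /= inE ys orbT.
have [|Va|[Y CY Ya]] := sub a; first by rewrite /= inE eqxx.
  by exists X => // y; rewrite /= inE => /orP[/eqP->|/sX //]; left.
have [XY|YX] := Ctot X Y CX CY.
  exists Y => // y; rewrite /= inE => /orP[/eqP->|/sX[]]; first by right.
    by left.
  by move=> /XY; right.
by exists X => // y; rewrite /= inE => /orP[/eqP->|/sX //]; right; apply: YX.
Qed.

Section Poset.
Context {d : Order.disp_t} {P : porderType d}.
Implicit Types (A D F G V W : set P) (Fs : set (set P)) (x s : P).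

Lemma up_up A : up (up A) `<=` up A.
Proof. by move=> z [y [x Ax xy] yz]; exists x => //; apply: le_trans yz. Qed.

Lemma up_subset A V : up V `<=` V -> A `<=` V -> up A `<=` V.
Proof. by move=> Vup AV y [x /AV Vx xy]; apply: Vup; exists x. Qed.

Lemma upU V W : up V `<=` V -> up W `<=` W -> up (V `|` W) `<=` V `|` W.
Proof.
move=> Vup Wup y [x [Vx|Wx] xy]; first by left; apply: Vup; exists x.
by right; apply: Wup; exists x.
Qed.

Lemma way_below_le F x y :
  way_below F [set x] -> x <= y -> way_below F [set y].
Proof.
move=> Fx xy D s Ddir Ds [_ -> ys]; apply: (Fx D s Ddir Ds).
by exists x => //; apply: le_trans ys.
Qed.

Lemma isLub_set1 x : isLub [set x] x.
Proof. by split=> [_ -> //|b]; apply. Qed.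

Lemma directed_set1 x : directed_set [set x].
Proof. by split; [exists x|move=> F _ Fx; exists x => // y /Fx ->]. Qed.

Lemma way_below_up F x : way_below F [set x] -> up F x.
Proof.
move=> Fx; have [|_ [-> //]] := Fx _ x (directed_set1 x) (isLub_set1 x).
by exists x.
Qed.

(** Enlarge V to a maximal upper set still containing no member of the
    family, which Zorn's lemma allows since the members are finite; its
    complement is the required directed set. Indeed, for x in the complement,
    maximality gives a member inside the enlarged set together with the upper
    set of x. For finitely many x, one member works for all of them; it has a
    point in the complement, which is then above every x. *)
Lemma rudin V Fs :
  up V `<=` V -> directed smyth Fs ->
  (forall F, Fs F -> finite_set F /\ ~ (F `<=` V)) ->
  exists D, [/\ directed_set D, D `<=` ~` V &
                forall F, Fs F -> F `&` D !=set0].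
Proof.
move=> Vup Fsdir FsP.
pose good W := up W `<=` W /\ forall F, Fs F -> ~ (F `<=` V `|` W).
have [|W [[Wup Wgood] Wmax]] := @Zorn_bigcup P good.
  move=> C Cgood Ctot; split.
    move=> y [x [X CX Xx] xy]; exists X => //.
    by apply: (Cgood X CX).1; exists x.
  move=> F FsF FC; have [finF nFV] := FsP F FsF.
  have [C0|C0] := pselect (C !=set0).
    have [X CX FX] := finite_sub_chain Ctot C0 finF FC.
    exact: (Cgood X CX).2 FX.
  by apply: nFV => x /FC[//|[X CX _]]; case: C0; exists X.
have Fs_meet F : Fs F -> F `&` ~` (V `|` W) !=set0.
  move=> FsF; apply: contrapT => F0; apply: (Wgood F FsF) => x Fx.
  by apply: contrapT => nx; apply: F0; exists x.
exists (~` (V `|` W)); split=> //; last by move=> x nx Vx; apply: nx; left.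
have bounded G : finite_set G -> G `<=` ~` (V `|` W) ->
    exists2 z, (~` (V `|` W)) z & forall x, G x -> x <= z.
  move=> finG GVW.
  pose Q x F := F `<=` (V `|` W) `|` up [set x].
  have [x F F'|x Gx|F FsF FQ] := directed_common_witness (Q := Q) Fsdir finG.
  - move=> FF' FQ; apply: (subset_trans (@sub_up _ _ F')).
    apply: (subset_trans FF'); apply: up_subset FQ.
    by apply: upU; [exact: upU|exact: up_up].
  - apply: contrapT => noF; apply: (Wmax (W `|` up [set x])).
      split=> [|sub]; first by move=> y; left.
      by apply: (GVW x Gx); right; apply: sub; right; exists x.
    split; first by apply: upU => //; exact: up_up.
    by move=> F FsF FV; apply: noF; exists F => //; rewrite /Q -setUA.
  have [z [Fz nz]] := Fs_meet F FsF; exists z => // x Gx.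
  by have [/nz //|[_ -> //]] := FQ x Gx z Fz.
split=> //.
by have [|//|z nz _] := bounded set0; [exact: finite_set0|exists z].
Qed.

Lemma rudin_sup V Fs :
  dcpo P -> up V `<=` V -> directed smyth Fs ->
  (forall F, Fs F -> finite_set F /\ ~ (F `<=` V)) ->
  exists D s, [/\ directed_set D, D `<=` ~` V, isLub D s &
                  forall F, Fs F -> up F s].
Proof.
move=> dcpoP Vup Fsdir FsP.
have [D [Ddir DV Dmeet]] := rudin Vup Fsdir FsP.
have [s Ds] := dcpoP D Ddir.
exists D, s; split=> // F FsF; have [x [Fx Dx]] := Dmeet F FsF.
by exists x => //; apply: Ds.1.
Qed.

(** This plays the part of interpolation in a continuous dcpo: some finite E with
    E way below an element of D is squeezed into the upper set of F, for
    otherwise Rudin's lemma gives a directed set that avoids this upper set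
    while its supremum lies above s. *)
Lemma scott_open_way_below F :
  dcpo P -> quasicontinuous P -> scott_open [set x | way_below F [set x]].
Proof.
move=> dcpoP qcP; split.
  apply/seteqP; split; first exact: sub_up.
  by move=> y [x Fx xy]; apply: way_below_le xy.
move=> D s Ddir Ds Fs; apply: contrapT => noF.
pose Es := [set E : set P | exists2 c, D c & fin c E].
have Esdir : directed smyth Es.
  split.
    have [c Dc] := Ddir.1; have [[[E cE] _] _] := qcP c.
    by exists E, c.
  move=> G finG GEs.
  (* A single c in D has all of G in [fin c], which is directed. *)
  have [E c c' cc' [finE Ec]|c Dc Gc] :=
    directed_common_witness (Q := fun E c => fin c E) Ddir finG _ GEs.
    by split=> //; apply: way_below_le cc'.
  have [E cE GE] := (qcP c).1.2 G finG Gc.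
  by exists E => //; exists c.
have EsF E : Es E -> finite_set E /\ ~ (E `<=` up F).
  move=> [c Dc [finE Ec]]; split=> // EF; apply: noF; exists c; split=> //.
  move=> D' t D'dir D't ct; have [y [D'y Ey]] := Ec D' t D'dir D't ct.
  by exists y; split=> //; apply: (up_subset (@up_up F) EF).
have [D' [t [D'dir D'F D't Est]]] := rudin_sup dcpoP (@up_up F) Esdir EsF.
have st : s <= t.
  apply: Ds.2 => c Dc.
  have : (\bigcap_(E in fin c) up E) t by move=> E cE; apply: Est; exists c.
  by rewrite -(qcP c).2 => -[_ ->].
have [|y [/D'F]//] := Fs D' t D'dir D't.
by exists s.
Qed.

Lemma one_step_subset_closure A : one_step A `<=` scott_closure A.
Proof.
move=> x [D [s [Ddir DA Ds xs]]] B; rewrite nbhsE => -[U [Uo Ux] UB].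
have [Uup Usup] : scott_open U by rewrite -scott_openE.
have [|y [Dy Uy]] := Usup D s Ddir Ds; first by rewrite Uup; exists x.
have [a [Aa ya]] := DA y Dy.
by exists a; split=> //; apply: UB; rewrite Uup; exists y.
Qed.

End Poset.

Theorem theorem3p3 (d : Order.disp_t) (P : porderType d)
  (dcpoP : dcpo P) (qcP : quasicontinuous P) : weak_one_step_closure P.
Proof.
move=> A; apply/seteqP; split; last exact: one_step_subset_closure.
move=> x clx.
have upC : up (~` down A) `<=` ~` down A.
  move=> z [y nAy yz] [a [Aa za]]; apply: nAy; exists a; split=> //.
  exact: le_trans za.
have finxA F : fin x F -> finite_set F /\ ~ (F `<=` ~` down A).
  move=> [finF Fx]; split=> // FA.
  have [|a [Aa Fa]] := clx [set y : P | way_below F [set y]].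
    apply: open_nbhs_nbhs; split=> //.
    by rewrite scott_openE; apply: scott_open_way_below.
  by have [y Fy ya] := way_below_up Fa; apply: (FA y Fy); exists a.
have [D [s [Ddir DA Ds finxs]]] := rudin_sup dcpoP upC (qcP x).1 finxA.
exists D, s; split=> //; first by move=> y /DA; rewrite setCK.
have : (\bigcap_(F in fin x) up F) s by exact: finxs.
by rewrite -(qcP x).2 => -[_ ->].
Qed.
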